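(* Let $G$ be a graph with $m\ge 1$ edges and no isolated edge. Label the edges of $G$ according to a uniformly random bijection $f:E(G)\to\{1,\ldots,m\}$, and for each vertex $v$ let $S_v=\sum_{e\ni v}f(e)$. Then with positive probability $S_v\neq S_w$ for every edge $vw\in E(G)$, i.e.\ the random labelling is a local antimagic labelling with positive probability. Moreover, this probability is $\Omega(1/m)$: there is an absolute constant $c>0$ such that for every such graph $G$ the probability is at least $c/m$.
   Context: Graphs are finite and simple. An isolated edge of $G$ is an edge forming a connected component isomorphic to $K_2$ (both endpoints have degree $1$). A local antimagic labelling of a graph with $m$ edges is a bijection $f:E(G)\to\{1,\ldots,m\}$ such that the sums $S_v=\sum_{e\ni v}f(e)$ satisfy $S_v\ne S_w$ for every pair of adjacent vertices $v,w$. *)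

(* Defs.v *)
From HB Require Import structures.
From mathcomp Require Import all_boot all_order all_algebra.

Set Implicit Arguments.
Unset Strict Implicit.
Unset Printing Implicit Defensive.

Import Order.TTheory GRing.Theory Num.Theory.

Record sgraph := SGraph {
  vertex :> finType;
  adj : rel vertex;
  adj_sym : symmetric adj;
  adj_irrefl : irreflexive adj
}.

Definition edges (G : sgraph) : {set {set G}} :=
  [set [set p.1; p.2] | p : G * G & adj p.1 p.2].

Lemma edges_adj (G : sgraph) (v w : G) : ([set v; w] \in edges G) = adj v w.
Proof.
apply/imsetP/idP => [[[x y]]|vw]; last by exists (v, w); rewrite ?inE.
rewrite inE /= => xy eq_vw; have nxy : x != y.
  by apply: contraTneq xy => ->; rewrite adj_irrefl.
have vxy : v \in [set x; y] by rewrite -eq_vw set21.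
have wxy : w \in [set x; y] by rewrite -eq_vw set22.
have nvw : v != w.
  have := cards2 v w; rewrite eq_vw cards2 nxy /= => /eqP.
  by case: (v != w).
move: vxy wxy nvw; rewrite !inE => /orP[]/eqP-> /orP[]/eqP->;
  by rewrite ?eqxx // adj_sym.
Qed.

Definition degree (G : sgraph) (v : G) : nat := #|[set w | adj v w]|.

Definition isolated_edge (G : sgraph) (d : {set G}) : bool :=
  (d \in edges G) && [forall v in d, degree v == 1].

Definition no_isolated_edge (G : sgraph) : Prop :=
  forall d : {set G}, ~~ isolated_edge d.

Definition edge (G : sgraph) : finType := {d : {set G} | d \in edges G}.

(* The ordinal i < m stands for the label i.+1 in {1, ..., m}. *)
Definition labelling (G : sgraph) : finType := {ffun edge G -> 'I_#|edges G|}.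

Definition bijections (G : sgraph) : {set labelling G} :=
  [set f : labelling G | injectiveb f & [forall i, exists d, f d == i]].

Lemma bijectionsP (G : sgraph) (f : labelling G) :
  reflect (bijective f) (f \in bijections G).
Proof.
rewrite inE; apply: (iffP andP) => [[/injectiveP f_inj _]|f_bij].
  by apply: inj_card_bij f_inj _; rewrite card_ord card_sig.
split; first by apply/injectiveP; exact: bij_inj.
case: f_bij => g _ gK.
by apply/forallP => i; apply/existsP; exists (g i); rewrite gK.
Qed.

Definition vertex_sum (G : sgraph) (f : labelling G) (v : G) : nat :=
  \sum_(d : edge G | v \in val d) (f d).+1.

Definition local_antimagic (G : sgraph) (f : labelling G) : bool :=
  [forall v, forall w, adj v w ==> (vertex_sum f v != vertex_sum f w)].

(* Probability of the event P for a uniformly random element of Omega. *)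
Definition uniform_prob (T : finType) (Omega : {set T}) (P : pred T) : rat :=
  (#|[set x in Omega | P x]|%:R / #|Omega|%:R)%R.

Definition prob_local_antimagic (G : sgraph) : rat :=
  uniform_prob (bijections G) (@local_antimagic G).

(* Main.v *)
Require Import Defs.
From mathcomp Require Import all_boot all_order all_algebra.
From mathcomp Require Import zify.

Set Implicit Arguments.
Unset Strict Implicit.
Unset Printing Implicit Defensive.

Import Order.TTheory GRing.Theory Num.Theory.

(**
First moment. For an edge [vw] give the edges of G the weight 1, -1 or 0
according to whether they meet only [v], only [w], or both or neither; there
are [a = deg v - 1] weights 1, [b = deg w - 1] weights -1 and [r >= 1] weights
0. Listing the weights by increasing label turns a random labelling into a
random word, and [S_v = S_w] says that its moment (the sum of position times
weight) vanishes. This has probability at most [(1 - 1/(40 m)) / m], except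
that it is exactly [1/m] for [a = b = 2], [m = 5]; a graph with 5 edges has an
edge of another kind, since its degrees sum to 10. Summing over the edges, the
labelling is local antimagic with probability at least [1/(40 m)].

For the bound, insert the [j] letters -1 (the movers) one at a time into the
word [u] formed by the [N = m - j] other letters. Moving the last mover across
a letter of [u] changes the moment strictly, and moving it across another mover
does not change it, so along its [m] possible positions a given value of the
moment is taken in one gap of [u] at most; counting a position next to another
mover as a word in which the two are glued together gives, by induction, that
each value has probability at most [1/(N+1)]. Reversing words shows that the
values 0 and [V = (a - b)(m + 1)] are equally likely, and while an unglued mover
runs through the word at most one of these two values occurs if [|V|] exceeds
the range [m + a - b]. Hence 0 has probability about [1/(2(N+1))], up to the
small error caused by glued movers. Taking the smaller class as movers if
[|a - b| >= 2] and the larger one if [|a - b| = 1], this is less than [1/m]. If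
[a = b], the first letter of a word does not contribute to its moment, and
removing it gives a word with [|a - b| = 1] or a shorter word with [a = b].
*)

(** * Sums over insertions *)

Definition insert (T : Type) i (x : T) w := take i w ++ x :: drop i w.

Lemma perm_insert (T : eqType) i (x : T) w : perm_eq (insert i x w) (x :: w).
Proof. by rewrite /insert -cat1s perm_catCA /= cat_take_drop. Qed.

Lemma insert_rev (T : Type) i (x : T) w : i <= size w ->
  rev (insert i x w) = insert (size w - i) x (rev w).
Proof.
move=> le_i; rewrite /insert rev_cat rev_cons cat_rcons take_rev drop_rev.
by rewrite subKn.
Qed.

(* The sum of [G] over all labelled permutations of [l]: equal letters count as
   distinct. *)
Fixpoint isum (T : Type) (l : seq T) (G : seq T -> nat) : nat :=
  if l is x :: l' then
    isum l' (fun w => \sum_(i < (size w).+1) G (insert i x w))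
  else G [::].

Lemma eq_isum (T : eqType) (l : seq T) G G' : (forall w, perm_eq w l -> G w = G' w) ->
  isum l G = isum l G'.
Proof.
elim: l G G' => [|x l IH] G G' eqG /=; first exact: eqG.
apply: IH => w w_l; apply: eq_bigr => i _; apply: eqG.
by rewrite (perm_trans (perm_insert _ _ _)) // perm_cons.
Qed.

Lemma leq_isum (T : eqType) (l : seq T) G G' : (forall w, perm_eq w l -> G w <= G' w) ->
  isum l G <= isum l G'.
Proof.
elim: l G G' => [|x l IH] G G' leG /=; first exact: leG.
apply: IH => w w_l; apply: leq_sum => i _; apply: leG.
by rewrite (perm_trans (perm_insert _ _ _)) // perm_cons.
Qed.

Lemma isumD (T : eqType) (l : seq T) G G' :
  isum l (fun w => G w + G' w) = isum l G + isum l G'.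
Proof.
elim: l G G' => [|x l IH] G G' //=.
by rewrite -IH; apply: eq_isum => w _; rewrite big_split.
Qed.

Lemma isumM (T : eqType) (l : seq T) k G : isum l (fun w => k * G w) = k * isum l G.
Proof.
elim: l G => [|x l IH] G //=.
by rewrite -IH; apply: eq_isum => w _; rewrite big_distrr.
Qed.

Lemma isum_const (T : eqType) (l : seq T) k : isum l (fun=> k) = (size l)`! * k.
Proof.
elim: l k => [|x l IH] k /=; first by rewrite fact0 mul1n.
rewrite (eq_isum (G' := fun=> (size l).+1 * k)) ?IH ?factS; first by lia.
by move=> w /perm_size <-; rewrite sum_nat_const card_ord.
Qed.

(** Splits off the movers: once the other letters form a word, the insertions can be bounded for
    each such word separately. *)
Fixpoint insn (T : Type) (y : T) j (G : seq T -> nat) : seq T -> nat :=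
  if j is j'.+1 then
    insn y j' (fun w => \sum_(i < (size w).+1) G (insert i y w))
  else G.

Lemma isum_nseq_cat (T : Type) j (y : T) l G :
  isum (nseq j y ++ l) G = isum l (insn y j G).
Proof. by elim: j G => //= j IH G; rewrite IH. Qed.

Lemma isum_rev (T : eqType) (l : seq T) G : isum l (fun w => G (rev w)) = isum l G.
Proof.
elim: l G => [|x l IH] G //=; rewrite -IH; apply: eq_isum => w _.
rewrite size_rev (reindex_inj rev_ord_inj) /=; apply: eq_bigr => i _.
by rewrite !subSS insert_rev size_rev ?leq_subr // revK subKn // -ltnS.
Qed.

(** A permutation of [x :: s] is recovered from the position of [x] and the rest. Both lists have
    the same length, so the inclusion forces equality and distinctness. *)
Lemma perm_permutations_insert (T : eqType) (x : T) s : uniq (x :: s) ->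
  perm_eq (permutations (x :: s))
    [seq insert i x p | p <- permutations s, i <- iota 0 (size s).+1].
Proof.
move=> Us; have Us' : uniq s by case/andP: Us.
set L := (X in perm_eq _ X).
have sub : {subset permutations (x :: s) <= L}.
  move=> p; rewrite mem_permutations => p_xs.
  have xp : x \in p by rewrite (perm_mem p_xs) mem_head.
  have ltip : index x p < size p by rewrite index_mem.
  have eq_p : p = insert (index x p) x (take (index x p) p ++ drop (index x p).+1 p).
    rewrite /insert take_size_cat ?drop_size_cat ?size_takel ?(ltnW ltip) //.
    by rewrite -{1}[p](cat_take_drop (index x p)) (drop_nth x) // nth_index.
  rewrite {1}eq_p; apply: allpairs_f.
    rewrite mem_permutations -(perm_cons x) (perm_trans _ p_xs) //.
    by rewrite perm_sym {1}eq_p perm_insert.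
  by rewrite mem_iota /= add0n -[(size s).+1]/(size (x :: s)) -(perm_size p_xs).
have le_size : size L <= size (permutations (x :: s)).
  by rewrite size_allpairs size_iota !size_permutations //= factS mulnC.
apply: uniq_perm; first exact: permutations_uniq.
  by apply: leq_size_uniq le_size; first exact: permutations_uniq.
by case: (uniq_min_size (permutations_uniq _) sub le_size).
Qed.

Lemma isum_permutations (S T : eqType) (c : S -> T) s G : uniq s ->
  isum (map c s) G = \sum_(p <- permutations s) G (map c p).
Proof.
elim: s G => [|x s IH] G Us; first by rewrite /= big_seq1.
rewrite (perm_big _ (perm_permutations_insert Us)) big_allpairs_dep.
rewrite [LHS]/= IH; last by case/andP: Us.
rewrite [LHS]big_seq [RHS]big_seq; apply: eq_bigr => p.
rewrite mem_permutations => /perm_size sz_p.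
rewrite size_map sz_p -[X in iota 0 X]subn0 -/(index_iota 0 _) big_mkord.
by apply: eq_bigr => i _; rewrite /insert map_cat map_take /= map_drop.
Qed.

Lemma isum_map (S T : eqType) (c : S -> T) l G :
  isum (map c l) G = isum l (G \o map c).
Proof.
elim: l G => [|x l IH] G //=; rewrite IH; apply: eq_isum => w _ /=.
rewrite size_map; apply: eq_bigr => i _.
by rewrite /insert map_cat map_take /= map_drop.
Qed.

(** Repeated letters are told apart by their indices, which turns both sides into sums over
    permutations of distinct indices. *)
Lemma isum_perm (T : eqType) (l l' : seq T) G :
  perm_eq l l' -> isum l G = isum l' G.
Proof.
case: l' => [/perm_nilP -> //|x l' pll'].
have /(perm_iotaP x)[Is pIs ->] := pll'.
rewrite -{2}[x :: l'](mkseq_nth x) /mkseq.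
have Uio := iota_uniq 0 (size (x :: l')).
rewrite !isum_permutations ?(perm_uniq pIs) //.
apply: perm_big; apply: uniq_perm; rewrite ?permutations_uniq // => p.
by rewrite !mem_permutations (permPr pIs).
Qed.

(** By induction: the letter inserted last either lands in front or leaves the first letter of the
    shorter word in place. *)
Lemma isum_first (T : eqType) (l : seq T) G : l != [::] ->
  isum l G = \sum_(x <- l) isum (rem x l) (fun w => G (x :: w)).
Proof.
elim: l G => // x l IH G _.
have [->|nl] := eqVneq l [::].
  by rewrite big_seq1 /= eqxx /= big_ord1.
rewrite big_cons /= eqxx (eq_isum (G' := fun w => G (x :: w) +
   \sum_(i < size w) G (insert i.+1 x w))); last first.
  by move=> w _; rewrite big_ord_recl /= /insert take0 drop0.
rewrite isumD; congr (_ + _); rewrite IH // [LHS]big_seq [RHS]big_seq.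
apply: eq_bigr => y yl; rewrite [LHS]/=.
transitivity (isum (x :: rem y l) (fun w => G (y :: w))) => //.
apply: isum_perm; have [->|] // := eqVneq x y.
by rewrite perm_sym perm_to_rem.
Qed.

(** * Moments and gaps *)

Definition weight (w : seq int) : int := (\sum_(x <- w) x)%R.

(** Summing the weights of all suffixes counts the letter in position [p], with positions starting
    at 1, exactly [p] times. *)
Fixpoint moment (w : seq int) : int :=
  if w is x :: w' then (weight w + moment w')%R else 0%R.

Lemma weight_cons x w : weight (x :: w) = (x + weight w)%R.
Proof. exact: big_cons. Qed.

Lemma weight_cat w1 w2 : weight (w1 ++ w2) = (weight w1 + weight w2)%R.
Proof. exact: big_cat. Qed.

Lemma weight_nseq n x : weight (nseq n x) = (n%:Z * x)%R.
Proof. by elim: n => [|n IH]; rewrite /= ?weight_cons ?IH /weight ?big_nil; lia. Qed.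

Lemma perm_weight w1 w2 : perm_eq w1 w2 -> weight w1 = weight w2.
Proof. exact: perm_big. Qed.

Lemma moment_cat w1 w2 :
  moment (w1 ++ w2) = (moment w1 + moment w2 + (size w1)%:Z * weight w2)%R.
Proof.
elim: w1 => [|x w1 IH] /=; first by lia.
by rewrite IH !weight_cons weight_cat; lia.
Qed.

(** Reversal sends position [p] to [size w + 1 - p]. *)
Lemma moment_rev w :
  moment (rev w) = ((size w).+1%:Z * weight w - moment w)%R.
Proof.
elim: w => [|x w IH] /=; first by rewrite /weight big_nil; lia.
rewrite rev_cons -cats1 moment_cat IH size_rev /= !weight_cons.
by rewrite /weight !big_nil; lia.
Qed.

Lemma moment_opp w : moment (map (@GRing.opp int) w) = (- moment w)%R.
Proof.
have weight_opp v : weight (map (@GRing.opp int) v) = (- weight v)%R.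
  by rewrite /weight big_map sumrN.
by elim: w => [|x w IH] //=; rewrite IH !weight_cons weight_opp; lia.
Qed.

Lemma moment_insert i x w : i <= size w ->
  moment (insert i x w) = (moment w + x * i.+1%:Z + weight (drop i w))%R.
Proof.
move=> le_iw; rewrite /insert moment_cat /= weight_cons size_takel //.
have := moment_cat (take i w) (drop i w).
by rewrite cat_take_drop size_takel //; lia.
Qed.

(* The gaps of a word of size [N] chosen by [j] movers inserted one after the
   other, the last one first. A gap that already holds [k] movers offers [k + 1]
   positions, hence the repetitions. *)
Fixpoint gaps N j : seq (seq nat) :=
  if j is j'.+1 then [seq g :: h | h <- gaps N j', g <- iota 0 N.+1 ++ h]
  else [:: [::]].

Lemma big_gapsS N j (F : seq nat -> nat) :
  \sum_(h <- gaps N j.+1) F h =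
  \sum_(h <- gaps N j) \sum_(g <- iota 0 N.+1 ++ h) F (g :: h).
Proof. by rewrite big_allpairs_dep. Qed.

(** The letters failing [a] are the movers; each contributes the number of fixed letters before
    it. *)
Fixpoint gap_list (T : Type) (a : pred T) (w : seq T) : seq nat :=
  if w is x :: w' then
    if a x then map succn (gap_list a w') else 0 :: gap_list a w'
  else [::].

(** Each gap has one position to start with and gains one more for every mover it holds. *)
Lemma perm_gap_positions (T : Type) (a : pred T) w :
  perm_eq [seq count a (take i w) | i <- iota 0 (size w).+1]
    (iota 0 (size (filter a w)).+1 ++ gap_list a w).
Proof.
elim: w => [|x w IH] //.
have -> : [seq count a (take i (x :: w)) | i <- iota 0 (size (x :: w)).+1]
  = 0 :: [seq a x + g | g <- [seq count a (take i w) | i <- iota 0 (size w).+1]].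
  rewrite -[iota 0 (size (x :: w)).+1]/(0 :: iota (1 + 0) (size w).+1) iotaDl.
  by rewrite map_cons -!map_comp.
rewrite -[filter a _]/(if a x then _ else _) [gap_list _ _]/=.
case: (a x).
  rewrite -[iota 0 (size (x :: _)).+1]/(0 :: iota (1 + 0) (size (filter a w)).+1).
  rewrite iotaDl.
  rewrite cat_cons perm_cons -[map succn _]/(map (addn 1) _) -map_cat.
  exact: perm_map.
rewrite (eq_map (g := id)) // map_id perm_sym (perm_catCA _ [:: 0]) perm_cons.
by rewrite perm_sym.
Qed.

Lemma gap_list_insert (T : Type) (a : pred T) y i w : ~~ a y -> i <= size w ->
  perm_eq (gap_list a (insert i y w)) (count a (take i w) :: gap_list a w).
Proof.
move=> ay; elim: w i => [|x w IH] [|i] //= le_iw; try by rewrite (negPf ay).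
rewrite -/(insert i y w); have {IH} := IH i le_iw; case: (a x) => IH.
  by rewrite add1n -map_cons; apply: perm_map.
rewrite add0n; apply: (@perm_trans _ (0 :: count a (take i w) :: gap_list a w)).
  by rewrite perm_cons.
by rewrite (perm_catCA [:: 0] [:: _]).
Qed.

Lemma eq_insn (T : eqType) (y : T) j u G G' : y \notin u ->
  (forall w, filter (predC1 y) w = u -> count_mem y w = j -> G w = G' w) ->
  insn y j G u = insn y j G' u.
Proof.
move=> yu; elim: j G G' => [|j IH] G G' eqG /=.
  apply: eqG; last exact/count_memPn.
  by apply/all_filterP/allP => x xu /=; apply: contraNneq yu => <-.
apply: IH => w w_u w_j; apply: eq_bigr => i _; apply: eqG.
  by rewrite /insert filter_cat /= eqxx -filter_cat cat_take_drop.
by rewrite (permP (perm_insert _ _ _)) /= eqxx w_j.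
Qed.

(** The change of the moment when a first mover enters gap [g]. *)
Definition phi (u : seq int) g : int := (weight (drop g u) - g.+1%:Z)%R.

(** Every mover already present lowers the change by 1: one on the left raises the position of the
    new mover, one on the right is itself shifted. *)
Lemma moment_insertN1 u w i : filter (predC1 (-1)%R) w = u -> i <= size w ->
  moment (insert i (-1)%R w) =
  (moment w - (count_mem (-1)%R w)%:Z + phi u (count (predC1 (-1)%R) (take i w)))%R.
Proof.
move=> <- le_iw; rewrite moment_insert // /phi.
set a := predC1 _.
have -> : drop (count a (take i w)) (filter a w) = filter a (drop i w).
  rewrite -{2}[w](cat_take_drop i) filter_cat drop_size_cat // size_filter //.
have tot v : weight v = (weight (filter a v) - (count_mem (-1)%R v)%:Z)%R.
  elim: v => [|x v IH]; first by rewrite /weight !big_nil.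
  by rewrite weight_cons IH /=; case: eqP => [->|_] /=; rewrite ?weight_cons; lia.
have i_eq : i = count a (take i w) + count_mem (-1)%R (take i w).
  rewrite -{1}(size_takel le_iw) -(count_predC a); congr (_ + _).
  by apply: eq_count => x /=; rewrite negbK.
have w_eq : count_mem (-1)%R w = count_mem (-1)%R (take i w) + count_mem (-1)%R (drop i w).
  by rewrite -count_cat cat_take_drop.
by rewrite (tot (drop i w)); lia.
Qed.

(** [F] sees the gaps besides the moment because the places offered to the next mover depend on
    them. It must ignore their order, as [gap_list] follows the word and [gaps] the insertions. Each
    pair of movers costs 1, hence the binomial. *)
Lemma insn_moment (u : seq int) j (F : seq nat -> int -> nat) : (-1)%R \notin u ->
  (forall h h' z, perm_eq h h' -> F h z = F h' z) ->
  insn (-1)%R j (fun w => F (gap_list (predC1 (-1)%R) w) (moment w)) u =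
  \sum_(h <- gaps (size u) j)
     F h (moment u - 'C(j, 2)%:Z + \sum_(g <- h) phi u g)%R.
Proof.
move=> yu; elim: j F => [|j IH] F permF.
  rewrite /= big_seq1 big_nil; have -> : gap_list (predC1 (-1)%R) u = [::].
    elim: u yu => //= x u IHu; rewrite inE negb_or eq_sym => /andP[-> /IHu].
    by move->.
  by congr F; rewrite bin0n; lia.
rewrite big_gapsS [LHS]/=; pose F' h (z : int) :=
  \sum_(g <- iota 0 (size u).+1 ++ h) F (g :: h) (z - j%:Z + phi u g)%R.
rewrite (eq_insn (G' := fun w => F' (gap_list (predC1 (-1)%R) w) (moment w))) //; last first.
  move=> w w_u w_j; rewrite /F' -w_u -(perm_big _ (perm_gap_positions _ _)).
  rewrite -[X in iota 0 X]subn0 -/(index_iota 0 _) big_map big_mkord.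
  apply: eq_bigr => i _; have le_iw : i <= size w by rewrite -ltnS.
  rewrite (moment_insertN1 (u := u)) // w_j w_u.
  by apply: permF; apply: gap_list_insert; rewrite //= eqxx.
rewrite IH; last first.
  move=> h h' z p_h; rewrite /F' (perm_big (iota 0 (size u).+1 ++ h')).
    by apply: eq_bigr => g _; apply: permF; rewrite perm_cons.
  by rewrite perm_cat2l.
apply: eq_bigr => h _; apply: eq_bigr => g _.
by rewrite big_cons binS bin1; congr F; set S := bigop _ _ _; lia.
Qed.

Fixpoint val_gaps (f : nat -> int) (ss h : seq nat) : int :=
  if ss is s :: ss' then
    if h is g :: h' then (s%:Z * f g + val_gaps f ss' h')%R else 0%R
  else 0%R.

(* A block of [s] glued movers is a mover of size [s]; [ss] lists the sizes. *)
Definition hits N f (Z : pred int) ss z :=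
  \sum_(h <- gaps N (size ss)) (Z (z + val_gaps f ss h)%R : nat).

Fixpoint add_nth (s : nat) (ss : seq nat) k : seq nat :=
  if ss is t :: ss' then
    if k is k'.+1 then t :: add_nth s ss' k' else t + s :: ss'
  else [::].

Lemma size_add_nth s ss k : size (add_nth s ss k) = size ss.
Proof. by elim: ss k => [|t ss IH] [|k] //=; rewrite IH. Qed.

Lemma size_gaps N j h : h \in gaps N j -> size h = j.
Proof.
elim: j h => [|j IH] h; first by rewrite inE => /eqP ->.
by case/allpairsPdep => h' [g [/IH <- _ ->]].
Qed.

Lemma val_gaps_add_nth f s ss h k : size h = size ss -> k < size ss ->
  val_gaps f (add_nth s ss k) h = (s%:Z * f (nth 0 h k) + val_gaps f ss h)%R.
Proof.
elim: ss h k => [|t ss IH] [|g h] [|k] //= [sz_h] lt_k; first by lia.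
by rewrite IH // addrCA.
Qed.

(* A mover inserted into the gap of an earlier one behaves as if the two were
   glued together into one mover of the added size. *)
Lemma hits_cons N f Z s ss z :
  hits N f Z (s :: ss) z =
  \sum_(h <- gaps N (size ss)) \sum_(g < N.+1)
     (Z (z + s%:Z * f g + val_gaps f ss h)%R : nat) +
  \sum_(k < size ss) hits N f Z (add_nth s ss k) z.
Proof.
rewrite /hits [size (_ :: _)]/= big_gapsS.
under [X in _ = _ + X]eq_bigr do rewrite size_add_nth.
rewrite [X in _ = _ + X]exchange_big -big_split big_seq [RHS]big_seq.
apply: eq_bigr => h /size_gaps sz_h.
rewrite big_cat -[X in iota 0 X]subn0.
rewrite -/(index_iota 0 _) big_mkord; congr (_ + _).
  by apply: eq_bigr => g _; rewrite addrA.
rewrite (big_nth 0) big_mkord sz_h; apply: eq_bigr => k _.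
by rewrite val_gaps_add_nth // addrA.
Qed.

(** * Exchangeability of the gap vectors *)

Fixpoint swap_nth (T : Type) n (s : seq T) : seq T :=
  match n, s with
  | 0, x :: y :: s' => y :: x :: s'
  | n'.+1, x :: s' => x :: swap_nth n' s'
  | _, _ => s
  end.

Lemma perm_swap_nth (T : eqType) n (s : seq T) : perm_eq (swap_nth n s) s.
Proof.
elim: n s => [|n IH] [|x s] //=; last by rewrite perm_cons.
by case: s => [|y s] //; rewrite (perm_catCA [:: y] [:: x]).
Qed.

(** A Polya urn: the later of two consecutive movers either joins the earlier one or chooses
    independently from the same list, and both cases are symmetric. *)
Lemma gaps_exchangeable N j n (F : seq nat -> nat) :
  \sum_(h <- gaps N j) F (swap_nth n h) = \sum_(h <- gaps N j) F h.
Proof.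
elim: n j F => [|n IH] [|j] F; rewrite ?big_seq1 //.
  case: j => [|j]; rewrite !big_gapsS.
    by rewrite /= !big_seq1.
  apply: eq_bigr => h _.
  have big_mid (J : seq nat) x E :
      \sum_(g <- J ++ x :: h) E g = E x + \sum_(g <- J ++ h) E g.
    by rewrite !big_cat big_cons addnCA.
  under eq_bigr do rewrite big_mid.
  under [RHS]eq_bigr do rewrite big_mid.
  by rewrite !big_split; congr addn; exact: exchange_big.
rewrite !big_gapsS.
rewrite -(IH j (fun h => \sum_(g <- iota 0 N.+1 ++ h) F (g :: h))).
apply: eq_bigr => h _; apply: perm_big.
by rewrite perm_cat2l perm_sym perm_swap_nth.
Qed.

(** * Counting gap vectors *)

Lemma sum_bool_le1 n (P : pred 'I_n) :
  (forall i j, P i -> P j -> i = j) -> \sum_(i < n) (P i : nat) <= 1.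
Proof.
move=> P1; case: (pickP P) => [i0 Pi0|P0]; last first.
  by rewrite big1 // => i _; rewrite P0.
rewrite (bigD1 i0) //= big1 ?addn0 ?leq_b1 // => i ni.
by case Pi: (P i) => //; rewrite (P1 _ _ Pi Pi0) eqxx in ni.
Qed.

Lemma size_gaps_ffact N j : size (gaps N j) = (N + j) ^_ j.
Proof.
elim: j => [|j IH]; first by rewrite ffactn0.
rewrite -sum1_size big_gapsS addnS ffactSS -IH.
rewrite (eq_big_seq (fun=> (N + j).+1)).
  by rewrite big_const_seq count_predT iter_addn_0.
by move=> h /size_gaps h_j; rewrite sum1_size size_cat size_iota h_j.
Qed.

Lemma sum_gaps_le N j k (F : seq nat -> nat) : (forall h, F h <= k) ->
  \sum_(h <- gaps N j) F h <= k * (N + j) ^_ j.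
Proof.
move=> Fk; rewrite -size_gaps_ffact -iter_addn_0 -(count_predT (gaps N j)).
by rewrite -big_const_seq; apply: leq_sum.
Qed.

Lemma all_add_nth s ss k :
  all (leq 1) ss -> all (leq 1) (add_nth s ss k).
Proof.
elim: ss k => [|t ss IH] [|k] //= /andP[t0 ss0]; last by rewrite t0 IH.
by rewrite ss0 addn_gt0 t0.
Qed.

(** The first block either takes one of the [N.+1] basic positions, where injectivity leaves it at
    most one, or is glued to another block. The two kinds of choices add up to the leading factor of
    the falling factorial. *)
Lemma hits_one N (f : nat -> int) t ss z :
  (forall g g', g <= N -> g' <= N -> f g = f g' -> g = g') ->
  ss != [::] -> all (leq 1) ss ->
  N.+1 * hits N f (pred1 t) ss z <= (N + size ss) ^_ (size ss).
Proof.
move=> f_inj; have [n] := ubnP (size ss); elim: n ss => // n IH [|s ss] // le_n _.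
case/andP=> s0 ss0; rewrite hits_cons mulnDr [size (_ :: _)]/= addnS ffactSS.
rewrite -addSn mulnDl leq_add ?leq_mul2l //=.
  rewrite -[X in _ <= X]mul1n; apply: sum_gaps_le => h.
  apply: sum_bool_le1 => g g' /eqP <- /eqP /addIr /addrI eq_f.
  apply: val_inj; apply: f_inj; rewrite ?leq_ord //.
  by apply/esym/(mulfI _ eq_f); lia.
rewrite big_distrr /= -[X in X * _](card_ord (size ss)) -sum_nat_const.
apply: leq_sum => k _; have := IH (add_nth s ss k); rewrite !size_add_nth.
apply=> //.
- by rewrite -size_eq0 size_add_nth -lt0n (leq_ltn_trans _ (ltn_ord k)).
- exact: all_add_nth.
Qed.

Lemma val_gaps_swap f n ss h : size h = size ss ->
  val_gaps f (swap_nth n ss) (swap_nth n h) = val_gaps f ss h.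
Proof.
elim: n ss h => [|n IH] [|s ss] [|g h] //= [sz_h]; last by rewrite IH.
by case: ss h sz_h => [|t ss] [|g' h] //= _; rewrite addrCA.
Qed.

Lemma hits_swap N f Z n ss z : hits N f Z (swap_nth n ss) z = hits N f Z ss z.
Proof.
rewrite /hits (perm_size (perm_swap_nth n ss)).
rewrite -(gaps_exchangeable _ _ n); apply: eq_big_seq => h /size_gaps sz_h.
by rewrite val_gaps_swap.
Qed.

Lemma swap_nth_cat (T : Type) (l r : seq T) x y :
  swap_nth (size l) (l ++ x :: y :: r) = l ++ y :: x :: r.
Proof. by elim: l => //= t l ->. Qed.

(** Exchangeability lets a glued block pass the unit movers, restoring the shape used in
    [hits_two]. *)
Lemma hits_move N f Z i k s rest z :
  hits N f Z (nseq i 1 ++ s :: nseq k 1 ++ rest) z =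
  hits N f Z (nseq (i + k) 1 ++ s :: rest) z.
Proof.
elim: k i => [|k IH] i; first by rewrite addn0.
rewrite -(hits_swap _ _ _ i) -{1}(size_nseq i 1) swap_nth_cat.
by rewrite -cat_rcons -cats1 -[[:: 1]]/(nseq 1 1) -nseqD addn1 IH addnS.
Qed.

Lemma add_nth_nseq i k s rest :
  add_nth s (nseq (i + k.+1) 1 ++ rest) i = nseq i 1 ++ 1 + s :: nseq k 1 ++ rest.
Proof. by elim: i => //= i ->. Qed.

Lemma add_nth_cat l r s k :
  add_nth s (l ++ r) (size l + k) = l ++ add_nth s r k.
Proof. by elim: l => //= t l ->. Qed.

(* Bounds the contribution of the words in which no mover is left unglued, when
   [s] movers are unglued and [r] are not. *)
Fixpoint excess N s r : nat :=
  if s is s'.+1 then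
    (if s' is s''.+1 then s' * excess N s'' r.+1 else 0) + r * excess N s' r
  else (N + r) ^_ r.

(** A unit mover meets at most one of the two values, so it is the one removed. It takes a basic
    position, pairs with another unit mover or joins a block; the last two are the branches of
    [excess]. *)
Lemma hits_two N (f : nat -> int) t1 t2 s rest z :
  (forall g g', g <= N -> g' <= N -> f g = f g' -> g = g') ->
  (forall y, \sum_(g < N.+1) (pred2 t1 t2 (y + f g)%R : nat) <= 1) ->
  0 < s + size rest -> all (leq 1) rest ->
  N.+1 * hits N f (pred2 t1 t2) (nseq s 1 ++ rest) z <=
  (N + (s + size rest)) ^_ (s + size rest) + excess N s (size rest).
Proof.
move=> f_inj hit1; elim/ltn_ind: s rest => -[|s] IH rest nz rest0.
  have nr : rest != [::] by rewrite -size_eq0 -lt0n.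
  rewrite [nseq _ _ ++ _]/= [excess _ _ _]/= add0n.
  (* With no unit mover left each value is bounded separately; the second copy of the bound is the
     excess. *)
  apply: leq_trans (leq_add (hits_one t1 z f_inj nr rest0) (hits_one t2 z f_inj nr rest0)).
  rewrite -mulnDr leq_mul2l /hits -big_split; apply/orP; right.
  apply: leq_sum => h _ /=; case: (_ == t1); case: (_ == t2) => //.
set r := size rest.
rewrite -[nseq _ _ ++ _]/(1 :: (nseq s 1 ++ rest)) hits_cons size_cat size_nseq -/r.
rewrite mulnDr addSn addnS ffactSS -[(N + _).+1]addSn mulnDl -addnA leq_add //.
  rewrite leq_mul2l; apply/orP; right; rewrite -[X in _ <= X]mul1n.
  apply: sum_gaps_le => h; apply: leq_trans (hit1 (z + val_gaps f (nseq s 1 ++ rest) h)%R).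
  by apply: leq_sum => g _; rewrite mul1r addrAC.
rewrite big_distrr big_split_ord /= mulnDl addnACA leq_add //.
  case: s IH nz => [|s] IH nz; first by rewrite big_ord0.
  rewrite -mulnDr -[X in X * _](card_ord s.+1) -sum_nat_const.
  apply: leq_sum => k _; have /subnKC eq_s : k <= s by rewrite -ltnS.
  rewrite -{1}eq_s -addnS add_nth_nseq hits_move eq_s.
  have := IH s (ltnW (ltnSn _)) (2 :: rest) _ _.
  by rewrite /= addnS -/r addSn; apply.
rewrite -mulnDr -[X in X * _](card_ord r) -sum_nat_const.
apply: leq_sum => k _; rewrite -[X in add_nth _ _ (X + _)](size_nseq s 1) add_nth_cat.
have := IH s (ltnSn _) (add_nth 1 rest k); rewrite size_add_nth -/r; apply.
  by rewrite addn_gt0 (leq_ltn_trans _ (ltn_ord k)) ?orbT.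
exact: all_add_nth.
Qed.

(** * Two values of the moment *)

Lemma weight_ge0 (v : seq int) : {in v, forall x, (0 <= x)%R} -> (0 <= weight v)%R.
Proof. by move=> v0; rewrite /weight big_seq sumr_ge0. Qed.

(** Advancing the mover across a letter [x] lowers [phi] by [1 + x]. *)
Lemma phi_range (u : seq int) g g' : {in u, forall x, (0 <= x)%R} ->
  g < g' <= size u ->
  (phi u g' < phi u g)%R /\ (phi u g - phi u g' <= (size u)%:Z + weight u)%R.
Proof.
move=> u0 /andP[lt_gg' le_g'].
have tot_drop k : weight u = (weight (take k u) + weight (drop k u))%R.
  by rewrite -weight_cat cat_take_drop.
have take0 k : (0 <= weight (take k u))%R.
  by apply: weight_ge0 => x /mem_take /u0.
have drop0 k : (0 <= weight (drop k u))%R.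
  by apply: weight_ge0 => x /mem_drop /u0.
have mid : (weight (drop g' u) <= weight (drop g u))%R.
  rewrite -(subnKC (ltnW lt_gg')) addnC -drop_drop.
  rewrite -{2}[drop g u](cat_take_drop (g' - g)) weight_cat lerDr.
  by apply: weight_ge0 => x /mem_take /mem_drop /u0.
have := tot_drop g; have := take0 g; have := drop0 g'.
by rewrite /phi; split; lia.
Qed.

(** The letters -1 stand first because [isum] inserts the head of its list last: they are the
    movers. *)
Definition letters i j r : seq int :=
  nseq j (-1)%R ++ nseq i 1%R ++ nseq r 0%R.

Lemma weight_letters i j r : weight (letters i j r) = (i%:Z - j%:Z)%R.
Proof. by rewrite !weight_cat !weight_nseq; lia. Qed.

Lemma size_letters i j r : size (letters i j r) = i + j + r.
Proof. by rewrite !size_cat !size_nseq; lia. Qed.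

Definition moment_count i j r (t : int) :=
  isum (letters i j r) (fun w => (moment w == t)).

Lemma moment_count_reflect i j r t :
  moment_count i j r t =
  moment_count i j r ((i + j + r).+1%:Z * (i%:Z - j%:Z) - t)%R.
Proof.
rewrite /moment_count -[RHS]isum_rev; apply: eq_isum => w p_w; congr nat_of_bool.
rewrite moment_rev (perm_weight p_w) (perm_size p_w) weight_letters size_letters.
by apply/eqP/eqP; lia.
Qed.

Lemma val_gaps_ones f h :
  val_gaps f (nseq (size h) 1) h = (\sum_(g <- h) f g)%R.
Proof. by elim: h => [|g h IH] /=; rewrite ?big_nil // big_cons IH mul1r. Qed.

Lemma moment_count_two_values i j r (V := ((i + j + r).+1%:Z * (i%:Z - j%:Z))%R) :
  0 < j -> ((i + r + i)%:Z < `|V|)%R ->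
  2 * (i + r).+1 * moment_count i j r 0 <=
  (i + r)`! * ((i + r + j) ^_ j + excess (i + r) j 0).
Proof.
move=> j0 ltV.
(* By reversal the values 0 and [V] are taken equally often, and they differ since [V] is
   nonzero. *)
have -> : 2 * (i + r).+1 * moment_count i j r 0 =
    (i + r).+1 * isum (letters i j r) (fun w => pred2 0%R V (moment w)).
  rewrite [2 * _]mulnC -mulnA mul2n -addnn; congr (_ * _).
  rewrite {2}moment_count_reflect subr0 -/V /moment_count -isumD.
  apply: eq_isum => w _ /=; case: eqP => [->|] //; case: eqP => // VE.
  by move: ltV; rewrite -VE; lia.
rewrite /letters isum_nseq_cat -isumM; set sol := nseq i _ ++ nseq r _.
have sz_sol : size sol = i + r by rewrite size_cat !size_nseq.
rewrite -{2}sz_sol -isum_const; apply: leq_isum => u p_u.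
have u_sol x : x \in u -> x = 1%R \/ x = 0%R.
  rewrite (perm_mem p_u) mem_cat => /orP[] /nseqP[-> _]; [by left|by right].
have u0 : {in u, forall x, (0 <= x)%R} by move=> x /u_sol[]->.
have Nu : (-1)%R \notin u by apply/negP => /u_sol[].
have sz_u : size u = i + r by rewrite (perm_size p_u).
have tot_u : weight u = Posz i.
  by rewrite (perm_weight p_u) weight_cat !weight_nseq; lia.
rewrite (@insn_moment _ _ (fun _ z => (pred2 0%R V z : nat))) // sz_u.
have -> : \sum_(h <- gaps (i + r) j)
     pred2 0%R V (moment u - 'C(j, 2)%:Z + \sum_(g <- h) phi u g)%R =
     hits (i + r) (phi u) (pred2 0%R V) (nseq j 1 ++ [::]) (moment u - 'C(j, 2)%:Z)%R.
  rewrite cats0 /hits size_nseq; apply: eq_big_seq => h /size_gaps sz_h.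
  by rewrite -val_gaps_ones sz_h.
have lt_phi g g' : g < g' <= i + r ->
    (phi u g' < phi u g)%R /\ (phi u g - phi u g' <= (i + r + i)%:Z)%R.
  by move=> lt_g; have := phi_range u0; rewrite sz_u tot_u => /(_ _ _ lt_g); lia.
rewrite -[X in excess _ _ X]/(size (Nil nat)) -{3 4}[j]addn0.
apply: hits_two; rewrite ?addn0 //.
  move=> g g' le_g le_g' eq_g; case: (ltngtP g g') => // lt_g.
    by case: (lt_phi g g'); rewrite ?lt_g ?le_g' // eq_g ltxx.
  by case: (lt_phi g' g); rewrite ?lt_g ?le_g // eq_g ltxx.
move=> y; apply: sum_bool_le1 => g g' Zg Zg'; apply: val_inj => /=.
have := leq_ord g; have := leq_ord g'; move: Zg Zg' => /=.
case: (ltngtP g g') => // lt_g Zg Zg' le_g le_g'.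
  have [] := lt_phi g g'; first by rewrite lt_g.
  by case/orP: Zg => /eqP Zg; case/orP: Zg' => /eqP Zg'; lia.
have [] := lt_phi g' g; first by rewrite lt_g.
by case/orP: Zg => /eqP Zg; case/orP: Zg' => /eqP Zg'; lia.
Qed.

(** * Recursion on the first letter *)

Lemma perm_letters1 i j r : perm_eq (letters i.+1 j r) (1%R :: letters i j r).
Proof. by rewrite (perm_catCA _ [:: 1%R]). Qed.

Lemma perm_letters0 i j r : perm_eq (letters i j r.+1) (0%R :: letters i j r).
Proof. by rewrite /letters !catA (perm_catCA _ [:: 0%R]). Qed.

Lemma perm_rem_cons (T : eqType) (x : T) s s' :
  perm_eq s (x :: s') -> perm_eq (rem x s) s'.
Proof.
move=> p_s; rewrite -(perm_cons x) -(permPr p_s) perm_sym perm_to_rem //.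
by rewrite (perm_mem p_s) mem_head.
Qed.

Lemma moment_count_opp i j r t :
  moment_count i j r t = moment_count j i r (- t)%R.
Proof.
rewrite /moment_count -[RHS](isum_perm (l := map (@GRing.opp int) (letters i j r))).
  rewrite isum_map; apply: eq_isum => w _ /=.
  by rewrite moment_opp eqr_opp.
by rewrite /letters !map_cat !map_nseq opprK oppr0 (perm_catCA (nseq j _)).
Qed.

(** Dropping the first letter lowers every position by 1, hence the moment by the total weight
    [d]. *)
Lemma moment_count_first i j r (d := (i%:Z - j%:Z)%R) t : 0 < i + j + r ->
  moment_count i j r t = i * moment_count i.-1 j r (t - d)%R +
    j * moment_count i j.-1 r (t - d)%R + r * moment_count i j r.-1 (t - d)%R.
Proof.
move=> m0; rewrite /moment_count isum_first; last by rewrite -size_eq0 size_letters -lt0n.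
pose F x := isum (rem x (letters i j r)) (fun w => (moment (x :: w) == t)).
have F_eq x l : perm_eq (letters i j r) (x :: l) ->
    F x = isum l (fun w => (moment w == t - d)%R).
  move=> p_l; rewrite /F (isum_perm _ (perm_rem_cons p_l)).
  apply: eq_isum => w p_w; congr nat_of_bool; rewrite /=.
  have -> : weight (x :: w) = d.
    by rewrite /d -(weight_letters i j r) (perm_weight p_l) !weight_cons (perm_weight p_w).
  by apply/eqP/eqP; lia.
have big_nseq_F n x : \sum_(y <- nseq n x) F y = n * F x.
  by rewrite big_nseq iter_addn_0 mulnC.
rewrite [LHS](_ : _ = \sum_(x <- letters i j r) F x) // {1}/letters.
rewrite !big_cat /= !big_nseq_F addnCA addnA.
congr (_ + _ + _).
- case: i @d F F_eq {m0 big_nseq_F} => // i d F F_eq; congr (_ * _).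
  exact/F_eq/perm_letters1.
- by case: j @d F F_eq {m0 big_nseq_F} => // j d F F_eq; congr (_ * _); exact: F_eq.
- case: r F F_eq {m0 big_nseq_F} => // r F F_eq; congr (_ * _).
  exact/F_eq/perm_letters0.
Qed.

(** The recursion on the first letter in computable form, with the length [n] as fuel. *)
Fixpoint moment_table n i j r (t : int) : nat :=
  if n is n'.+1 then
    let t' := (t - (i%:Z - j%:Z))%R in
    i * moment_table n' i.-1 j r t' + j * moment_table n' i j.-1 r t' +
    r * moment_table n' i j r.-1 t'
  else (t == 0%R).

Lemma moment_tableE n i j r t : i + j + r = n ->
  moment_count i j r t = moment_table n i j r t.
Proof.
elim: n i j r t => [|n IH] i j r t eq_n.
  have [-> [-> ->]] : i = 0 /\ j = 0 /\ r = 0 by lia.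
  by rewrite /moment_count /= eq_sym.
rewrite moment_count_first /=; last by rewrite eq_n.
congr (_ + _ + _).
- by case: i eq_n => // i eq_n; rewrite IH //; lia.
- by case: j eq_n => // j eq_n; rewrite IH //; lia.
- by case: r eq_n => // r eq_n; rewrite IH //; lia.
Qed.

Lemma moment_count_221 : moment_count 2 2 1 0 = 24.
Proof. by rewrite (@moment_tableE 5) //; vm_compute. Qed.

Lemma moment_count_222 : moment_count 2 2 2 0 = 112.
Proof. by rewrite (@moment_tableE 6) //; vm_compute. Qed.

Lemma moment_le0 (w : seq int) : {in w, forall x, (x <= 0)%R} ->
  (moment w <= 0)%R.
Proof.
elim: w => //= x w IH w0; have w0' : {in w, forall y, (y <= 0)%R}.
  by move=> y yw; apply: w0; rewrite inE yw orbT.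
have : (weight (x :: w) <= 0)%R by rewrite /weight big_seq sumr_le0.
by have := IH w0'; lia.
Qed.

(** The moment is the total weight [-j] plus the moment of the tail, which is not positive. *)
Lemma moment_count_0j j r : 0 < j -> moment_count 0 j r 0 = 0.
Proof.
move=> j0; transitivity (isum (letters 0 j r) (fun=> 0)); last first.
  by rewrite isum_const muln0.
apply: eq_isum => w p_w; have := perm_weight p_w; rewrite weight_letters.
have : {in w, forall x, (x <= 0)%R}.
  move=> x; rewrite (perm_mem p_w) !mem_cat => /orP[/nseqP[-> _]|/orP[]] //.
  by case/nseqP=> ->.
case: w {p_w} => [|x w] w0; first by rewrite /weight big_nil; lia.
have := @moment_le0 w; move=> /(_ _) w_le0 tot; case: eqP => //= m0.
have : (moment w <= 0)%R by apply: w_le0 => y yw; apply: w0; rewrite inE yw orbT.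
by move: m0 tot => /=; lia.
Qed.

Lemma moment_count_i0 i r : 0 < i -> moment_count i 0 r 0 = 0.
Proof. by rewrite moment_count_opp oppr0; apply: moment_count_0j. Qed.

(** For weight 0 the first letter does not affect the moment, and by negation the choices 1 and -1
    count equally. *)
Lemma moment_count_balanced a r : 0 < a ->
  moment_count a a r 0 =
  2 * a * moment_count a.-1 a r 0 + r * moment_count a a r.-1 0.
Proof.
move=> a0; rewrite moment_count_first ?addn_gt0 ?a0 // subrr subr0.
by rewrite (moment_count_opp a a.-1) oppr0 mul2n -addnn mulnDl.
Qed.

Lemma moment_count_11 r : moment_count 1 1 r 0 = 0.
Proof.
elim: r => [|r IH]; rewrite moment_count_balanced //= moment_count_0j //.
by rewrite IH !muln0.
Qed.

(** * Numerical bounds *)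

Lemma ffact_addS N j : (N + j.+1) ^_ j.+1 = (N + j.+1) * (N + j) ^_ j.
Proof. by rewrite addnS ffactSS. Qed.

Lemma excessS_le N s r c B :
  (0 < s -> c * excess N s.-1 r.+1 <= B) -> c * excess N s r <= B ->
  c * excess N s.+1 r <= (s + r) * B.
Proof.
move=> B1 B2; rewrite mulnDl [excess _ _.+1 _]/= mulnDr.
apply: leq_add; last by rewrite mulnCA leq_mul2l B2 orbT.
case: s B1 {B2} => [|s] B1; first by rewrite muln0.
by rewrite mulnCA leq_mul2l B1.
Qed.

(** Each recursion step multiplies by a factor at most half of the one the falling factorial gains.
    A step uses up at most two unit movers, so there are at least [uphalf s] steps. *)
Lemma excess_geometric N s r : s + r <= N.+2 ->
  2 ^ uphalf s * excess N s r <= (N + (s + r)) ^_ (s + r).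
Proof.
elim/ltn_ind: s r => -[|s] IH r le_N; first by rewrite mul1n.
rewrite addSn ffact_addS.
apply: (@leq_trans ((s + r) * (2 * (N + (s + r)) ^_ (s + r)))); last first.
  by rewrite mulnA leq_mul2r; apply/orP; right; lia.
apply: excessS_le => [s0|].
  have -> : uphalf s.+1 = (uphalf s.-1).+1 by case: s s0 {IH le_N}.
  rewrite expnS -mulnA leq_mul2l /=.
  by have := IH s.-1 _ r.+1; rewrite -(prednK s0) /= addSn addnS; apply; lia.
apply: (@leq_trans (2 * (2 ^ uphalf s * excess N s r))).
  rewrite mulnA -expnS leq_mul2r leq_exp2l // [uphalf _]/=; apply/orP; right; lia.
by rewrite leq_mul2l /= IH //; lia.
Qed.

Lemma excess_le0 N s r : s + r <= N.+2 ->
  excess N s r <= (N + (s + r)) ^_ (s + r).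
Proof.
move=> /excess_geometric; apply: leq_trans.
by rewrite -[X in X <= _]mul1n leq_mul2r expn_gt0 orbT.
Qed.

(** Here and in the next two lemmas the recursion is unrolled one, two or three times before the
    crude bound [excess_le0] is applied. *)
Lemma excess_le1 N s r : s.+1 + r <= N.+2 ->
  excess N s.+1 r <= (s + r) * (N + (s + r)) ^_ (s + r).
Proof.
move=> le_N; rewrite -[X in X <= _]mul1n; apply: excessS_le => [s0|]; rewrite mul1n.
  have -> : s + r = s.-1 + r.+1 by lia.
  by apply: excess_le0; lia.
by apply: excess_le0; lia.
Qed.

Lemma excess_le2 N s r : s.+3 + r <= N.+2 ->
  excess N s.+3 r <= (s.+2 + r) * ((s.+1 + r) * (N + (s.+1 + r)) ^_ (s.+1 + r)).
Proof.
move=> le_N; rewrite -[X in X <= _]mul1n; apply: excessS_le => [s0|]; rewrite mul1n.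
  by have := @excess_le1 N s r.+1; rewrite !addnS -!addSn; apply; lia.
by apply: excess_le1; lia.
Qed.

Lemma excess_le3 N s r : s.+4.+1 + r <= N.+2 ->
  excess N s.+4.+1 r <= (s.+4 + r) *
    ((s.+3 + r) * ((s.+2 + r) * (N + (s.+2 + r)) ^_ (s.+2 + r))).
Proof.
move=> le_N; rewrite -[X in X <= _]mul1n; apply: excessS_le => [s0|]; rewrite mul1n.
  by have := @excess_le2 N s r.+1; rewrite !addnS -!addSn; apply; lia.
by apply: excess_le2; lia.
Qed.

(** Serves [excess_bound] with [j = n + 9]; 9 is the first value from which the geometric estimate
    suffices. *)
Lemma exp2_uphalf n : 5 * (n + 9) <= 4 * 2 ^ uphalf (n + 7).
Proof.
elim/ltn_ind: n => -[|[|n]] IH //.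
have := IH n (leqnSn _); rewrite !addSn /= expnS; lia.
Qed.

Lemma excess_bound3 N : 2 <= N -> 4 * excess N 1 1 <= (N + 2) ^_ 2.
Proof.
move=> le_N; rewrite ffact_addS; apply: leq_mul; first by lia.
by rewrite /excess /= add0n mul1n.
Qed.

(** The cases [j = 4] to [j = 8] unroll the recursion; the others follow from the geometric
    estimate. *)
Lemma excess_bound N j : 4 <= j -> j <= N.+1 ->
  5 * j * excess N (j - 2) 1 <= 4 * (N + (j - 1)) ^_ (j - 1).
Proof.
case: j => [|[|[|[|[|[|[|[|[|j]]]]]]]]] // _ le_N; rewrite ?subSS ?subn0.
- rewrite /= !ffact_addS ffactn0.
  have : 5 * (N + 1) * (N + 3) <= (N + 2) * (N + 1) * (N + 3).
    by rewrite !leq_mul2r; apply/orP; right; apply/orP; right; lia.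
  by nia.
- have : excess N 3 1 <= 3 * (2 * (N + 2) ^_ 2) by apply: (@excess_le2 N 0 1); lia.
  rewrite (ffact_addS N 3) (ffact_addS N 2); set F := _ ^_ 2; set A := excess _ _ _.
  have : 150 * F <= 4 * ((N + 4) * (N + 3)) * F.
    by rewrite leq_mul2r; apply/orP; right; nia.
  by lia.
- have : excess N 4 1 <= 4 * (3 * (N + 3) ^_ 3) by apply: (@excess_le2 N 1 1); lia.
  rewrite (ffact_addS N 4) (ffact_addS N 3); set F := _ ^_ 3; set A := excess _ _ _.
  have : 360 * F <= 4 * ((N + 5) * (N + 4)) * F.
    by rewrite leq_mul2r; apply/orP; right; nia.
  by lia.
- have : excess N 5 1 <= 5 * (4 * (3 * (N + 3) ^_ 3)) by apply: (@excess_le3 N 0 1); lia.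
  rewrite (ffact_addS N 5) (ffact_addS N 4) (ffact_addS N 3).
  set F := _ ^_ 3; set A := excess _ _ _.
  have le1 : 12 * (11 * 10) <= (N + 6) * ((N + 5) * (N + 4)).
    by rewrite !leq_mul //; lia.
  have : 2100 * F <= 4 * ((N + 6) * ((N + 5) * (N + 4))) * F.
    by rewrite leq_mul2r; apply/orP; right; lia.
  by lia.
- have : excess N 6 1 <= 6 * (5 * (4 * (N + 4) ^_ 4)) by apply: (@excess_le3 N 1 1); lia.
  rewrite (ffact_addS N 6) (ffact_addS N 5) (ffact_addS N 4).
  set F := _ ^_ 4; set A := excess _ _ _.
  have le1 : 14 * (13 * 12) <= (N + 7) * ((N + 6) * (N + 5)).
    by rewrite !leq_mul //; lia.
  have : 4800 * F <= 4 * ((N + 7) * ((N + 6) * (N + 5))) * F.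
    by rewrite leq_mul2r; apply/orP; right; lia.
  by lia.
have le_ex : 2 ^ uphalf (j + 7) * excess N (j + 7) 1 <= (N + (j + 8)) ^_ (j + 8).
  by have := @excess_geometric N (j + 7) 1; rewrite -!addnA; apply; lia.
have le_pow := exp2_uphalf j; rewrite -[j.+4.+3]/(7 + j) -[j.+4.+4]/(8 + j).
rewrite -[(8 + j).+1]/(9 + j) ![_ + j]addnC; move: le_pow le_ex.
set p := 2 ^ _; set A := excess _ _ _; set F := _ ^_ _ => le_pow le_ex.
apply: (@leq_trans (4 * p * A)); first by rewrite leq_mul2r le_pow orbT.
by rewrite -mulnA leq_mul2l.
Qed.

(** * Bounds for the number of words of moment zero *)

Lemma fact_mul_ffact N j : N`! * (N + j) ^_ j = (N + j)`!.
Proof. by rewrite mulnC -{2}(addnK j N) ffact_fact ?leq_addl. Qed.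

(** At the start no block exists, so the first mover can only be glued to one of the [j - 1]
    others. *)
Lemma excess_full N j : 0 < j ->
  excess N j 0 = (j - 1) * excess N (j - 2) 1.
Proof. by case: j => [|[|j]] // _; rewrite !subSS !subn0 /= addn0. Qed.

Lemma excess_top N j : 1 <= j -> j <= N.+1 ->
  (j - 1) * excess N (j - 2) 1 <= (N + (j - 1)) ^_ (j - 1).
Proof.
case: j => [|[|[|[|j]]]] // _ le_N; rewrite ?subSS ?subn0.
- by rewrite mul1n.
- by have := @excess_bound3 N; lia.
have := @excess_bound N j.+4 isT le_N; rewrite !subSS !subn0.
set A := excess _ _ _; set F := _ ^_ _; nia.
Qed.

Lemma moment_count_unbalanced i j r (m := i + j + r) :
  0 < j -> 0 < r -> (j + 2 <= i) || (j == i + 1) ->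
  m * (m + 2) * moment_count i j r 0 <= m.+1 * m`!.
Proof.
move=> j0 r0 ij; have le_jN : j <= (i + r).+1 by lia.
have := @moment_count_two_values i j r j0; set c := moment_count _ _ _ _.
(* The left side is [m + (i - j)]. For [i = j + 1] it would equal the right side, hence the larger
   class supplies the movers when the sizes differ by 1. *)
have -> : ((i + r + i)%:Z < `|(i + j + r).+1%:Z * (i%:Z - j%:Z)|)%R.
  by case/orP: ij => [le_ji|/eqP->]; [nia | lia].
move/(_ isT); rewrite excess_full // mulnDr fact_mul_ffact => le_c.
have : (i + r)`! * ((j - 1) * excess (i + r) (j - 2) 1) <= (i + r + (j - 1))`!.
  by rewrite -(fact_mul_ffact (i + r) (j - 1)) leq_mul2l excess_top ?orbT.
have m1 : i + r + (j - 1) = m.-1 by rewrite /m; lia.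
have m_eq : i + r + j = m by rewrite /m; lia.
rewrite m1 m_eq in le_c *; move=> /(leq_add (leqnn m`!)) /(leq_trans le_c) {}le_c.
have m0 : 0 < m by rewrite /m; lia.
have fm : m`! = m * m.-1`! by rewrite -{1}(prednK m0) factS prednK.
have le_N : m + 2 <= 2 * (i + r).+1 by rewrite /m; case/orP: ij => [|/eqP->]; lia.
apply: (@leq_trans (m * (2 * (i + r).+1 * c))).
  by rewrite -mulnA leq_mul2l leq_mul2r le_N !orbT.
apply: (@leq_trans (m * (m`! + m.-1`!))); first by rewrite leq_mul2l le_c orbT.
by rewrite mulnDr -fm; lia.
Qed.

(** Removing a nonzero first letter leaves classes of sizes [a - 1] and [a], the larger one being
    the movers; the words starting with 0 give the last term. *)
Lemma moment_count_balanced_le a r (B := (a.-1 + r)`! * excess (a.-1 + r) (a - 2) 1) :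
  2 <= a ->
  (a + r) * moment_count a a r 0 <=
  a * ((2 * a + r).-1`! + (a - 1) * B) + r * (a + r) * moment_count a a r.-1 0.
Proof.
move=> a2; have a0 : 0 < a by lia.
rewrite moment_count_balanced // mulnDr; apply: leq_add; last by rewrite mulnCA mulnA.
have := @moment_count_two_values a.-1 a r a0; set c := moment_count a.-1 _ _ _.
have -> : ((a.-1 + r + a.-1)%:Z <
    `|(a.-1 + a + r).+1%:Z * (a.-1%:Z - a%:Z)|)%R by lia.
move/(_ isT); rewrite excess_full // mulnDr fact_mul_ffact mulnCA -/B.
have -> : a.-1 + r + a = (2 * a + r).-1 by lia.
have -> : (a.-1 + r).+1 = a + r by lia.
by move=> /(leq_mul (leqnn a)); apply: leq_trans; lia.
Qed.

(** The inequality [c / m! <= (1 - 1/(40 m)) / m] cleared of denominators. *)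
Definition small_count m c := 40 * m ^ 2 * c <= (40 * m - 1) * m`!.

Lemma small_count_fact m c : 0 < m -> small_count m c -> c <= m.-1`!.
Proof.
case: m => // m _; rewrite /small_count factS -mulnn /=.
set F := m`! => le_c; rewrite -(@leq_pmul2l (40 * (m.+1 * m.+1))) //.
apply: leq_trans le_c _; rewrite !mulnA leq_mul2r; apply/orP; right.
by rewrite leq_mul2r; apply/orP; right; lia.
Qed.

(** The balanced estimate bounds [k * c] with [k = a + r]; taking [(m - 2)!] as the unit leaves
    polynomial inequalities. *)
Lemma small_count_reduce m c k : 1 < m -> 0 < k ->
  40 * m * (k * c) + m.-1 * k * (m - 2)`! <= 40 * m * (m.-1 * k * (m - 2)`!) ->
  small_count m c.
Proof.
case: m => [|[|m]] // _ k0; rewrite /small_count !factS [m.+2 - 2]subSS [m.+1 - 1]subSS subn0.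
rewrite -mulnn [m.+2.-1]/=; set M := m`! => le_kc.
have : k * (40 * m.+2 * c + m.+1 * M) <= k * (40 * m.+2 * (m.+1 * M)) by lia.
rewrite leq_pmul2l // => /(leq_mul (leqnn m.+2)).
by have -> : 40 * m.+2 - 1 = 40 * m.+1 + 39; lia.
Qed.

Lemma balanced_excess_le a r (N := a.-1 + r) : 3 <= a ->
  5 * a * (N`! * excess N (a - 2) 1) <= 4 * (2 * a + r - 2)`!.
Proof.
move=> a3; have -> : 2 * a + r - 2 = N + (a - 1) by rewrite /N; lia.
rewrite -fact_mul_ffact mulnCA [4 * _]mulnCA leq_mul2l; apply/orP; right.
have [a4|a_lt4] := leqP 4 a; first by apply: excess_bound; rewrite // /N; lia.
have le_N : 1 < N by rewrite /N; lia.
have -> : a = 3 by lia.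
rewrite -[3 - 2]/1 -[3 - 1]/2; have := excess_bound3 le_N.
by set A := excess _ _ _; set F := _ ^_ _; lia.
Qed.

Lemma moment_count_balanced_large a r : 3 <= a -> 0 < r ->
  small_count (2 * a + r) (moment_count a a r 0).
Proof.
move=> a3; elim: r => // r IH _.
have a2 : 1 < a by lia.
have step k := @moment_count_balanced_le a k a2.
have exc k := @balanced_excess_le a k a3.
have fact_pred n : 0 < n -> n`! = n * n.-1`! by case: n => // n _; rewrite factS.
apply: (@small_count_reduce _ _ (a + r.+1)); try lia.
have := step r.+1; have := exc r.+1.
have -> : (2 * a + r.+1).-1`! = (2 * a + r) * (2 * a + r.+1 - 2)`!.
  by rewrite fact_pred; [congr (_ * _`!)|]; lia.
set c := moment_count a a r.+1 0; set B := _`! * _.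
have -> : (2 * a + r.+1).-1 = 2 * a + r by lia.
(* With a single zero the shorter word has none and lies outside the induction; the same estimate
   with [r = 0] replaces it. *)
rewrite [r.+1.-1]/=; case: r IH => [|r] IH in c B *.
  move=> {IH} le_B le_c; have := step 0; have := exc 0.
  have [a_lt4|a4] := ltnP a 4.
    have a_eq : a = 3 by lia.
    move: @c @B le_B le_c {step exc}; rewrite {}a_eq => c B _.
    have -> : B = 24 by [].
    have -> : (2 * 3 + 1 - 2)`! = 120 by [].
    have -> : (3.-1 + 0)`! * excess (3.-1 + 0) (3 - 2) 1 = 6 by [].
    by set c' := moment_count 3 3 0 0; lia.
  have -> : (2 * a + 0).-1`! = (2 * a + 1 - 2)`! by congr _`!; lia.
  have M_eq : (2 * a + 1 - 2)`! = (2 * a - 1) * (2 * a + 0 - 2)`!.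
    by rewrite fact_pred; [congr (_ * _`!)|]; lia.
  move: le_B le_c; rewrite {}M_eq; set M := _`!; set B0 := _`! * _.
  set c' := moment_count a a 0 0; rewrite mul0n mul0n !addn0 leq_pmul2l; last by lia.
  case: a a4 {a3 a2 step exc} @c @B @M @B0 @c' => [|[|[|[|a]]]] // _ c B M B0 c'.
  have -> : 2 * a.+4 - 1 = 2 * a + 7 by lia.
  rewrite !subSS subn0 => le_B le_c le_B0 le_c'.
  have := leq_mul (leqnn (5 * a.+4 * (a + 5))) le_c'.
  have := leq_mul (leqnn ((a + 5) * (a + 3))) le_B0.
  have := leq_mul (leqnn (a.+4 * (a + 3))) le_B.
  have := leq_mul (leqnn (5 * a.+4)) le_c => le1 le2 le3 le4.
  (* Eliminating [c'], [B0] and [B] leaves a polynomial times [M]; the multiplier [5 * a.+4] clears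
     the denominators of the excess bounds. *)
  have main : 5 * a.+4 * ((a.+4 + 1) * c) <= (5 * a.+4 * a.+4 * (2 * a.+4) * (2 * a + 7) +
     4 * (a.+4 * (a + 3)) * (2 * a + 7) + (a + 5) * (5 * a.+4 * (2 * a + 7) + 4 * (a + 3))) * M.
    by lia.
  have poly : 40 * (2 * a.+4 + 1) * (5 * a.+4 * a.+4 * (2 * a.+4) * (2 * a + 7) +
     4 * (a.+4 * (a + 3)) * (2 * a + 7) + (a + 5) * (5 * a.+4 * (2 * a + 7) + 4 * (a + 3))) +
     5 * a.+4 * (2 * a.+4 * (a.+4 + 1) * (2 * a + 7)) <=
     5 * a.+4 * (40 * (2 * a.+4 + 1) * (2 * a.+4 * (a.+4 + 1) * (2 * a + 7))).
    by nia.
  have := leq_mul poly (leqnn M).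
  have := leq_mul (leqnn (40 * (2 * a.+4 + 1))) main => le5 le6.
  rewrite -(@leq_pmul2l (5 * a.+4)) //; lia.
(* From two zeros on, the induction hypothesis enters in its weak form, a bound by a factorial; the
   strict gain comes from the excess bound on [B]. *)
have {IH} := small_count_fact _ (IH isT); rewrite addn_gt0 muln_gt0 (ltnW a2).
have -> : (2 * a + r.+1).-1 = 2 * a + r.+2 - 2 by lia.
move/(_ isT); set c' := moment_count a a r.+1 0; set M := _`!.
move=> le_c' le_B le_c.
case: a a3 {a2 step exc} @c @B @c' @M le_c' le_B le_c => // a a3 c B c' M.
rewrite subSS subn0 => le_c' le_B le_c.
have le_c'2 := leq_mul (leqnn (5 * (r.+2 * (a.+1 + r.+2)))) le_c'.
have le_B2 := leq_mul (leqnn a) le_B.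
have main : 5 * ((a.+1 + r.+2) * c) + a * r.+2 * M <=
    5 * ((2 * a.+1 + r.+1) * (a.+1 + r.+2)) * M.
  have le_r := leq_mul (leq_mul (leqnn (4 * a)) (leq0n r)) (leqnn M).
  by lia.
have poly : (2 * a.+1 + r.+1) * (a.+1 + r.+2) <= 8 * (2 * a.+1 + r.+2) * (a * r.+2).
  by nia.
have := leq_mul poly (leqnn M).
have := leq_mul (leqnn (8 * (2 * a.+1 + r.+2))) main.
by lia.
Qed.

(** The induction starts at the tabulated case [r = 2], since [r = 1] is the exceptional case with
    probability exactly [1/m]. *)
Lemma moment_count_22 r : 2 <= r -> small_count (4 + r) (moment_count 2 2 r 0).
Proof.
case: r => [|[|r]] // _; elim: r => [|r IH].
  rewrite /small_count moment_count_222 -[4 + 2]/6.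
  by have -> : 6`! = 720 by []; lia.
apply: (@small_count_reduce _ _ (2 + r.+3)); try lia.
have := @moment_count_balanced_le 2 r.+3 isT.
have := @small_count_fact (4 + r.+2) _ isT IH.
rewrite [r.+3.-1]/= [2.-1]/= -[(2 * 2 + r.+3).-1]/(4 + r.+2).
rewrite -[excess _ _ _]/((1 + r.+3 + 1) ^_ 1).
rewrite [_`! * _]fact_mul_ffact.
have -> : (4 + r.+2)`! = (r + 6) * (r + 5)`!.
  by rewrite -[r + 6]/(r + (1 + 5)) addnCA -factS; congr _`!; lia.
have -> : 1 + r.+3 + 1 = r + 5 by lia.
have -> : (4 + r.+2).-1 = r + 5 by lia.
have -> : 4 + r.+3 - 2 = r + 5 by lia.
have -> : 4 + r.+2 = r + 6 by lia.
set c := moment_count 2 2 r.+3 0; set c' := moment_count 2 2 r.+2 0.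
set M := (r + 5)`! => le_c' le_c.
have := leq_mul (leqnn (r.+3 * (2 + r.+3))) le_c' => le_c'2.
have le1 : (2 + r.+3) * c + (r + 1) * M <= (r + 6) * (2 + r.+3) * M by lia.
have poly : (r + 6) * (2 + r.+3) <= 40 * (4 + r.+3) * (r + 1) by nia.
have := leq_mul poly (leqnn M).
have := leq_mul (leqnn (40 * (4 + r.+3))) le1.
by lia.
Qed.

Lemma small_count_unbalanced i j r :
  0 < j -> 0 < r -> (j + 2 <= i) || (j == i + 1) ->
  small_count (i + j + r) (moment_count i j r 0).
Proof.
move=> j0 r0 ij; have := moment_count_unbalanced j0 r0 ij.
rewrite /small_count -mulnn; have : 0 < i + j + r by lia.
move: (i + j + r) (moment_count i j r 0) => m c m0; set F := m`! => le_c.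
rewrite -(@leq_pmul2l (m + 2)) ?addn2 //.
apply: (@leq_trans (40 * m * (m.+1 * F))).
  by have := leq_mul (leqnn (40 * m)) le_c; lia.
have -> : 40 * m - 1 = 40 * m.-1 + 39 by lia.
have poly : 40 * m * m.+1 <= m.+2 * (40 * m.-1 + 39) by nia.
by have := leq_mul poly (leqnn F); lia.
Qed.

Lemma moment_count_small i j r : 0 < r -> 0 < i + j ->
  ~~ [&& i == 2, j == 2 & r == 1] ->
  small_count (i + j + r) (moment_count i j r 0).
Proof.
move=> r0 ij0 exc.
case: (posnP i) => [i_eq0|i0].
  by rewrite i_eq0 in ij0 *; rewrite moment_count_0j // /small_count muln0.
case: (posnP j) => [j_eq0|j0].
  by rewrite j_eq0 moment_count_i0 // /small_count muln0.
have [lt_ij|lt_ji|eq_ij] := ltngtP i j.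
- have [le_j|gt_j] := leqP (i + 2) j.
    rewrite moment_count_opp oppr0 (addnC i); apply: small_count_unbalanced => //.
    by rewrite le_j.
  by apply: small_count_unbalanced => //; apply/orP; right; lia.
- have [le_i|gt_i] := leqP (j + 2) i.
    by apply: small_count_unbalanced => //; rewrite le_i.
  rewrite moment_count_opp oppr0 (addnC i); apply: small_count_unbalanced => //.
  by apply/orP; right; lia.
rewrite -{}eq_ij addnn -mul2n in exc *; have [i3|lt_i3] := leqP 3 i.
  exact: moment_count_balanced_large.
have [i_eq1|i_eq2] : i = 1 \/ i = 2 by lia.
  by rewrite i_eq1 moment_count_11 /small_count muln0.
rewrite i_eq2 in exc *; apply: moment_count_22.
by move: exc; rewrite /=; lia.
Qed.

(** * Labellings of graphs *)

(** In label order the element [d] has position [f d + 1 - k]; the start [k] is free for the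
    induction. *)
Lemma moment_map_labels (T : Type) (c : T -> int) (f : T -> nat) p k :
  map f p = iota k (size p) ->
  moment (map c p) = (\sum_(d <- p) c d * ((f d).+1%:Z - k%:Z))%R.
Proof.
elim: p k => [|d p IH] k /=; first by rewrite big_nil.
case=> fd /IH ->; rewrite big_cons fd weight_cons /weight big_map -addrA.
congr (_ + _)%R; first by lia.
by rewrite -big_split; apply: eq_bigr => e _ /=; lia.
Qed.

Lemma perm_letters (l : seq int) :
  (forall x, x \in l -> [|| x == 1, x == -1 | x == 0]%R) ->
  perm_eq l (letters (count_mem 1%R l) (count_mem (-1)%R l) (count_mem 0%R l)).
Proof.
elim: l => // x l IH l3; have /IH p_l y : y \in l -> [|| y == 1, y == -1 | y == 0]%R.
  by move=> yl; apply: l3; rewrite inE yl orbT.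
have := l3 x (mem_head _ _); case/or3P => /eqP -> /=; rewrite ?add0n ?add1n perm_sym.
- by rewrite (permPl (perm_letters1 _ _ _)) perm_cons perm_sym.
- by rewrite /letters /= perm_cons perm_sym.
- by rewrite (permPl (perm_letters0 _ _ _)) perm_cons perm_sym.
Qed.

(** For a bijection [f], its inverse written as a word. *)
Definition label_order (T : finType) n (f : {ffun T -> 'I_n}) : seq T :=
  sort (relpre (fun d => f d : nat) leq) (enum T).

Lemma map_label_order (T : finType) n (f : {ffun T -> 'I_n}) :
  injective f -> #|T| = n -> map (fun d => f d : nat) (label_order f) = iota 0 n.
Proof.
move=> f_inj card_T; rewrite /label_order -sort_map.
apply: (sorted_eq leq_trans anti_leq); first by apply: sort_sorted; exact: leq_total.
  exact: iota_sorted.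
rewrite perm_sort; have U : uniq [seq f d : nat | d <- enum T].
  by rewrite map_inj_uniq ?enum_uniq // => d e /val_inj /f_inj.
apply: uniq_perm; rewrite ?iota_uniq //.
have sub : {subset [seq f d : nat | d <- enum T] <= iota 0 n}.
  by move=> i /mapP[d _ ->]; rewrite mem_iota /= add0n.
have le_n : size (iota 0 n) <= size [seq f d : nat | d <- enum T].
  by rewrite size_iota size_map -cardE card_T.
by case: (uniq_min_size U sub le_n).
Qed.

(** [label_order] maps these labellings injectively to the permutations whose word has moment 0. *)
Lemma card_labellings_moment0 (T : finType) n (c : T -> int) : #|T| = n ->
  #|[set f : {ffun T -> 'I_n} | injectiveb f &
      (\sum_d c d * (f d).+1%:Z == 0)%R]| <=
  isum (map c (enum T)) (fun w => (moment w == 0%R)).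
Proof.
move=> card_T; set A := [set f | _ & _].
rewrite isum_permutations ?enum_uniq //.
set L := permutations _; set P := fun p => moment (map c p) == 0%R.
have -> : \sum_(p <- L) P p = size [seq p <- L | P p].
  by rewrite size_filter -sum1_count [RHS]big_mkcond; apply: eq_bigr => p _; case: P.
rewrite cardE -(size_map (@label_order T n)); apply: uniq_leq_size.
  rewrite map_inj_in_uniq ?enum_uniq // => f g; rewrite !mem_enum !inE.
  move=> /andP[/injectiveP f_inj _] /andP[/injectiveP g_inj _] eq_fg.
  have := map_label_order f_inj card_T.
  rewrite -(map_label_order g_inj card_T) eq_fg => /eq_in_map eq_val.
  by apply/ffunP => d; apply/val_inj/eq_val; rewrite mem_sort mem_enum.
move=> p /mapP[f]; rewrite mem_enum inE => /andP[/injectiveP f_inj /eqP sum0] ->.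
have map_f := map_label_order f_inj card_T.
have sz : size (label_order f) = n by rewrite size_sort -cardE.
rewrite mem_filter mem_permutations perm_sort perm_refl andbT /P.
rewrite (@moment_map_labels _ c (fun d => f d : nat) _ 0) ?sz //.
have -> : (\sum_(d <- label_order f) c d * ((f d).+1%:Z - 0%:Z) = 
           \sum_d c d * (f d).+1%:Z)%R.
  rewrite (perm_big (enum T)) ?big_enum //=; last by rewrite perm_sort.
  by apply: eq_bigr => d _; rewrite subr0.
by rewrite sum0.
Qed.

(** * Signs of edges and bad labellings *)

Lemma card_edge (G : sgraph) : #|edge G| = #|edges G|.
Proof. exact: card_sig. Qed.

Lemma bijections_injective (G : sgraph) (f : labelling G) :
  (f \in bijections G) = injectiveb f.
Proof.
apply/bijectionsP/injectiveP => [/bij_inj //|f_inj].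
by apply: inj_card_bij; rewrite ?card_ord ?card_edge.
Qed.

Lemma card_bijections (G : sgraph) : #|bijections G| = #|edges G|`!.
Proof.
have -> : bijections G = [set f : labelling G | injectiveb f].
  by apply/setP => f; rewrite bijections_injective inE.
by rewrite card_inj_ffuns card_ord card_edge ffactnn.
Qed.

Definition edge_sign (G : sgraph) (v w : G) (d : edge G) : int :=
  ((v \in val d)%:Z - (w \in val d)%:Z)%R.

Lemma eq_vertex_sum (G : sgraph) (f : labelling G) v w :
  (vertex_sum f v == vertex_sum f w) =
  (\sum_d edge_sign v w d * (f d).+1%:Z == 0)%R.
Proof.
have vsE u : Posz (vertex_sum f u) =
    (\sum_(d : edge G) (u \in val d)%:Z * (f d).+1%:Z)%R.
  rewrite /vertex_sum big_mkcond (big_morph Posz PoszD (erefl (Posz 0))).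
  by apply: eq_bigr => d _; case: (u \in val d); rewrite ?mul1r ?mul0r.
rewrite -(eqr_nat int) !natz -subr_eq0 !vsE -sumrB; congr (_ == _).
by apply: eq_bigr => d _; rewrite /edge_sign mulrBl.
Qed.

Lemma edgeP (G : sgraph) (d : edge G) :
  exists x y : G, adj x y /\ val d = [set x; y].
Proof.
case: d => d /= /imsetP[[x y]]; rewrite inE /= => xy ->.
by exists x, y.
Qed.

Lemma adj_neq (G : sgraph) (v w : G) : adj v w -> v != w.
Proof. by apply: contraTneq => ->; rewrite adj_irrefl. Qed.

Lemma edge_mem2 (G : sgraph) (d : edge G) v w :
  v != w -> v \in val d -> w \in val d -> val d = [set v; w].
Proof.
move=> nvw; have [x [y [_ ->]]] := edgeP d; rewrite !inE.
move=> /orP[]/eqP Ev /orP[]/eqP Ew; rewrite Ev Ew ?eqxx // in nvw *.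
exact: setUC.
Qed.

Lemma card_bad_labellings (G : sgraph) (v w : G)
    (l := map (edge_sign v w) (enum (edge G))) : adj v w ->
  #|[set f in bijections G | vertex_sum f v == vertex_sum f w]| <=
  moment_count (count_mem 1%R l) (count_mem (-1)%R l) (count_mem 0%R l) 0.
Proof.
move=> vw; rewrite /moment_count -(isum_perm _ (perm_letters _)); last first.
  move=> x /mapP[d _ ->]; rewrite /edge_sign.
  by case: (v \in val d); case: (w \in val d).
apply: leq_trans (card_labellings_moment0 _ (card_edge G)); apply: subset_leq_card.
by apply/subsetP => f; rewrite in_set bijections_injective eq_vertex_sum inE.
Qed.

(** Only the edge [vw] contains both ends; it has sign 0 and is the one edge at either end missing
    from the nonzero counts. *)
Lemma count_edge_sign (G : sgraph) (v w : G) (l := map (edge_sign v w) (enum (edge G))) :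
  adj v w ->
  [/\ count_mem 1%R l + count_mem (-1)%R l + count_mem 0%R l = #|edges G|,
      0 < count_mem 0%R l,
      count_mem 1%R l = #|[set d : edge G | v \in val d]|.-1 &
      count_mem (-1)%R l = #|[set d : edge G | w \in val d]|.-1].
Proof.
move=> vw; have nvw := adj_neq vw.
have d0P : [set v; w] \in edges G by rewrite edges_adj.
pose d0 : edge G := exist _ [set v; w] d0P.
have countE x : count_mem x l = #|[set d | edge_sign v w d == x]|.
  rewrite count_map -sum1_count -sum1_card big_enum_cond /=.
  by apply: eq_bigl => d; rewrite !inE.
have d0_eq (d : edge G) : v \in val d -> w \in val d -> d = d0.
  by move=> vd wd; apply: val_inj; rewrite (edge_mem2 nvw vd wd).
split.
- rewrite -size_letters -(perm_size (perm_letters _)); last first.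
    move=> x /mapP[d _ ->]; rewrite /edge_sign.
    by case: (v \in val d); case: (w \in val d).
  by rewrite size_map -cardE card_edge.
- rewrite -has_count; apply/hasP; exists 0%R => //; apply/mapP; exists d0.
    by rewrite mem_enum.
  by rewrite /edge_sign /= set21 set22.
- rewrite countE.
  suff -> : [set d : edge G | v \in val d] = d0 |: [set d | edge_sign v w d == 1%R].
    by rewrite cardsU1 inE /edge_sign /= set21 set22.
  apply/setP => d; rewrite !inE /edge_sign.
  have [->|nd] /= := eqVneq d d0; first by rewrite /= set21.
  case vd: (v \in val d); case wd: (w \in val d) => //.
  by rewrite (d0_eq d vd wd) eqxx in nd.
- rewrite countE.
  suff -> : [set d : edge G | w \in val d] = d0 |: [set d | edge_sign v w d == (-1)%R].
    by rewrite cardsU1 inE /edge_sign /= set21 set22.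
  apply/setP => d; rewrite !inE /edge_sign.
  have [->|nd] /= := eqVneq d d0; first by rewrite /= set22.
  case vd: (v \in val d); case wd: (w \in val d) => //.
  by rewrite (d0_eq d vd wd) eqxx in nd.
Qed.

(** If all signs vanished, every edge at one end would contain the other, so both ends would have
    degree 1 and [vw] would be isolated. *)
Lemma edge_sign_nonzero (G : sgraph) (v w : G)
    (l := map (edge_sign v w) (enum (edge G))) :
  no_isolated_edge G -> adj v w ->
  0 < count_mem 1%R l + count_mem (-1)%R l.
Proof.
move=> no_iso vw; rewrite lt0n; apply/negP; rewrite addn_eq0 => /andP[/eqP c1 /eqP cN1].
have nvw := adj_neq vw.
have sign0 d : edge_sign v w d = 0%R.
  have dl : edge_sign v w d \in l by apply: map_f; rewrite mem_enum.
  have /count_memPn n1 := c1; have /count_memPn nN1 := cN1.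
  move: dl n1 nN1; rewrite /edge_sign.
  by case: (v \in val d); case: (w \in val d) => //= ->.
have mem_vw (d : edge G) : (v \in val d) = (w \in val d).
  by have := sign0 d; rewrite /edge_sign; case: (v \in _); case: (w \in _).
have deg1 x y : adj x y -> (forall d : edge G, x \in val d -> y \in val d) ->
    degree x == 1.
  move=> xy sub; rewrite /degree.
  suff -> : [set z | adj x z] = [set y] by rewrite cards1.
  apply/setP => z; rewrite !inE; apply/idP/eqP => [xz|-> //].
  have xzP : [set x; z] \in edges G by rewrite edges_adj.
  have := sub (exist (fun d : {set G} => d \in edges G) _ xzP).
  rewrite /= set21 => /(_ isT); rewrite !inE.
  by rewrite eq_sym (negPf (adj_neq xy)) /= eq_sym => /eqP.
have := no_iso [set v; w]; rewrite /isolated_edge edges_adj vw /=; apply/negP/negPn.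
apply/forall_inP => x; rewrite !inE => /orP[]/eqP->.
  by apply: (deg1 v w vw) => d; rewrite mem_vw.
by apply: (deg1 w v); [rewrite adj_sym|move=> d; rewrite mem_vw].
Qed.

Definition bad_labellings (G : sgraph) (d : edge G) : {set labelling G} :=
  [set f in bijections G | [exists v, exists w,
     [&& adj v w, val d == [set v; w] & vertex_sum f v == vertex_sum f w]]].

Lemma bad_labellingsE (G : sgraph) (d : edge G) v w : adj v w ->
  val d = [set v; w] ->
  bad_labellings d = [set f in bijections G | vertex_sum f v == vertex_sum f w].
Proof.
move=> vw d_vw; apply/setP => f; rewrite !in_set; congr (_ && _).
apply/existsP/idP => [[x /existsP[y /and3P[xy /eqP]]]|Ef]; last first.
  by exists v; apply/existsP; exists w; rewrite vw d_vw eqxx.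
rewrite d_vw => eq_d Ef.
have : x \in [set v; w] by rewrite eq_d set21.
have : y \in [set v; w] by rewrite eq_d set22.
have := adj_neq xy; rewrite !inE => nxy /orP[]/eqP Ey /orP[]/eqP Ex;
  rewrite Ex Ey ?eqxx // in nxy Ef *.
by rewrite eq_sym.
Qed.

(** The union bound, by counting pairs of a labelling and an edge whose ends have equal sums. *)
Lemma card_not_local_antimagic (G : sgraph) :
  #|[set f in bijections G | ~~ local_antimagic f]| <=
  \sum_(d : edge G) #|bad_labellings d|.
Proof.
rewrite -sum1_card.
apply: (@leq_trans (\sum_(f : labelling G) \sum_(d : edge G) (f \in bad_labellings d))).
  rewrite big_mkcond; apply: leq_sum => f _; case: ifP => //; rewrite in_set.
  case/andP=> f_bij; rewrite /local_antimagic negb_forall => /existsP[v].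
  rewrite negb_forall => /existsP[w]; rewrite negb_imply negbK => /andP[vw Ef].
  have dP : [set v; w] \in edges G by rewrite edges_adj.
  rewrite (bigD1 (exist (fun d : {set G} => d \in edges G) _ dP)) //=.
  by rewrite (bad_labellingsE vw) // in_set f_bij Ef.
rewrite exchange_big; apply: leq_sum => d _.
by rewrite -sum1_card [X in _ <= X]big_mkcond; apply: leq_sum => f _; case: (f \in _).
Qed.

(** The excluded triple [a = b = 2], [r = 1] means five edges in all and three edges at each end. *)
Lemma card_bad_labellings_small (G : sgraph) (d : edge G) v w :
  no_isolated_edge G -> adj v w -> val d = [set v; w] ->
  #|edges G| != 5 \/ #|[set e : edge G | v \in val e]| != 3 \/
    #|[set e : edge G | w \in val e]| != 3 ->
  small_count #|edges G| #|bad_labellings d|.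
Proof.
move=> no_iso vw d_vw exc; rewrite (bad_labellingsE vw d_vw).
have [sum_m r0 a_eq b_eq] := count_edge_sign vw.
have ab0 := edge_sign_nonzero no_iso vw.
have le_bad := card_bad_labellings vw.
move: sum_m r0 a_eq b_eq ab0 le_bad; set l := map _ _.
move: (count_mem 1%R l) (count_mem (-1)%R l) (count_mem 0%R l) => a b r.
move=> sum_m r0 a_eq b_eq ab0 le_bad.
have exc2 : ~~ [&& a == 2, b == 2 & r == 1].
  by apply/negP => /and3P[/eqP a2 /eqP b2 /eqP r1]; lia.
have := moment_count_small r0 ab0 exc2; rewrite sum_m /small_count.
by apply: leq_trans; rewrite leq_mul2l le_bad orbT.
Qed.

(** The bound is [(m - 1)!]: the exceptional count equals it, and [small_count] implies it in the
    other cases. *)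
Lemma card_bad_labellings_5 (G : sgraph) (d : edge G) :
  no_isolated_edge G -> #|edges G| = 5 -> #|bad_labellings d| <= 24.
Proof.
move=> no_iso m5; have [v [w [vw d_vw]]] := edgeP d.
rewrite (bad_labellingsE vw d_vw).
have [sum_m r0 _ _] := count_edge_sign vw.
have ab0 := edge_sign_nonzero no_iso vw.
have le_bad := card_bad_labellings vw.
move: sum_m r0 ab0 le_bad; set l := map _ _.
move: (count_mem 1%R l) (count_mem (-1)%R l) (count_mem 0%R l) => a b r.
move=> sum_m r0 ab0 le_bad; apply: leq_trans le_bad _.
have [/and3P[/eqP-> /eqP-> /eqP->]|exc] := boolP [&& a == 2, b == 2 & r == 1].
  by rewrite moment_count_221.
have := small_count_fact _ (moment_count_small r0 ab0 exc).
by rewrite sum_m m5; apply.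
Qed.

(* The degrees sum to 10, so they cannot all be 0 or 3. *)
Lemma degree_not3 (G : sgraph) : #|edges G| = 5 ->
  exists d : edge G, exists v w, [/\ adj v w, val d = [set v; w] &
    #|[set e : edge G | v \in val e]| != 3].
Proof.
move=> m5; pose D v := #|[set e : edge G | v \in val e]|.
case: (pickP (fun v : G => (0 < D v) && (D v != 3))) => [v /andP[]|D3].
  case/card_gt0P=> d; rewrite inE => vd nD3; exists d.
  have [x [y [xy d_xy]]] := edgeP d; rewrite d_xy !inE in vd.
  case/orP: vd => /eqP vE; [exists v, y|exists v, x]; split=> //; rewrite vE //.
    by rewrite adj_sym.
  by rewrite d_xy setUC.
have sumD : \sum_(v : G) D v = 10.
  transitivity (\sum_(v : G) \sum_(d : edge G) (v \in val d)).
    apply: eq_bigr => v _; rewrite /D -sum1_card big_mkcond /=.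
    by apply: eq_bigr => d _; rewrite inE; case: (v \in _).
  rewrite exchange_big (eq_bigr (fun=> 2)) => [|d _].
    by rewrite sum_nat_const card_edge m5.
  have [x [y [xy d_xy]]] := edgeP d; have := cards2 x y.
  rewrite (adj_neq xy) -d_xy => <-; rewrite -sum1_card [RHS]big_mkcond /=.
  by apply: eq_bigr => v _; case: (v \in _).
have : 3 %| \sum_(v : G) D v.
  by apply: dvdn_sum => v _; have := D3 v; case: (D v) => [|n] //= /negbFE/eqP->.
by rewrite sumD.
Qed.

Lemma card_local_antimagic (G : sgraph) : 0 < #|edges G| -> no_isolated_edge G ->
  #|edges G|`! <=
  40 * #|edges G| * #|[set f in bijections G | local_antimagic f]|.
Proof.
move=> m0 no_iso; have le_bad := card_not_local_antimagic G.
have := cardsID [set f | local_antimagic f] (bijections G).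
have -> : bijections G :&: [set f | local_antimagic f] =
    [set f in bijections G | local_antimagic f].
  by apply/setP => f; rewrite in_setI !in_set.
have -> : bijections G :\: [set f | local_antimagic f] =
    [set f in bijections G | ~~ local_antimagic f].
  by apply/setP => f; rewrite in_setD andbC !in_set.
rewrite card_bijections; move: le_bad.
set bad := #|[set f in _ | ~~ _]|; set good := #|[set f in _ | local_antimagic f]|.
move=> le_bad eq_m.
have [m5|m5] := eqVneq #|edges G| 5.
  have [d [v [w [vw d_vw nD]]]] := degree_not3 m5.
  (* The margin in [small_count] reads [1000 * c <= 199 * 120], so [c] is at most 23. *)
  have lt24 : #|bad_labellings d| <= 23.
    have : small_count 5 #|bad_labellings d|.
      by rewrite -m5; apply: card_bad_labellings_small vw d_vw _ => //; right; left.
    by rewrite /small_count; have -> : 5`! = 120 by []; lia.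
  (* Since [119 = 23 + 4 * 24], at least one of the 120 labellings is good, and [40 * 5] exceeds
     120. *)
  have le_119 : bad <= 119.
    apply: leq_trans le_bad _; rewrite (bigD1 d) //=.
    apply: (@leq_trans (23 + \sum_(e : edge G | e != d) 24)).
      apply: leq_add => //; apply: leq_sum => e _; exact: card_bad_labellings_5.
    rewrite sum_nat_const; have -> : #|[pred e : edge G | e != d]| = 4.
      by have := cardC1 d; rewrite card_edge m5.
    by [].
  rewrite m5 in eq_m *; have f5 : 5`! = 120 by [].
  by rewrite f5 in eq_m *; lia.
(* Summing over the [m] edges cancels one factor [m] and leaves at least a fraction [1/(40 m)] of
   good labellings. *)
have le_sum : 40 * #|edges G| ^ 2 * bad <=
    #|edges G| * ((40 * #|edges G| - 1) * #|edges G|`!).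
  apply: (@leq_trans (\sum_(d : edge G) 40 * #|edges G| ^ 2 * #|bad_labellings d|)).
    by rewrite -big_distrr /= leq_mul2l le_bad orbT.
  rewrite -[X in _ <= X * _]card_edge -sum_nat_const; apply: leq_sum => d _.
  have [v [w [vw d_vw]]] := edgeP d.
  by apply: card_bad_labellings_small vw d_vw _ => //; left.
move: eq_m le_sum; rewrite -mulnn; move: (#|edges G|) m0 => m m0; set F := m`!.
move=> eq_m le_sum.
have : 40 * m * bad <= (40 * m - 1) * F.
  by rewrite -(@leq_pmul2l m) //; lia.
by rewrite -{}eq_m; nia.
Qed.

(** * The probability bound *)

Local Open Scope ring_scope.

Lemma ler_ratio (k m F g : nat) : (0 < k)%N -> (0 < m)%N -> (0 < F)%N ->
  (F <= k * m * g)%N -> k%:R^-1 / m%:R <= g%:R / F%:R :> rat.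
Proof.
move=> k0 m0 F0 le_F; rewrite ler_pdivlMr ?ltr0n // -invfM mulrC.
by rewrite ler_pdivrMr ?mulr_gt0 ?ltr0n // mulrC -!natrM ler_nat; lia.
Qed.

Theorem theorem12 :
  (forall G : sgraph, (1 <= #|edges G|)%N -> no_isolated_edge G ->
     0 < prob_local_antimagic G) /\
  (exists c : rat, 0 < c /\
     forall G : sgraph, (1 <= #|edges G|)%N -> no_isolated_edge G ->
       c / #|edges G|%:R <= prob_local_antimagic G).
Proof.
(* The quantitative bound is shown first, with [c = 1/40]; it implies positivity. *)
have [c c0 bound] : exists2 c : rat, 0 < c & forall G : sgraph,
    (1 <= #|edges G|)%N -> no_isolated_edge G ->
    c / #|edges G|%:R <= prob_local_antimagic G.
  exists 40%:R^-1; first by rewrite invr_gt0 ltr0n.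
  move=> G m0 no_iso; rewrite /prob_local_antimagic /uniform_prob card_bijections.
  by apply: ler_ratio; rewrite ?fact_gt0 //; apply: card_local_antimagic.
split=> [G m0 no_iso|]; last by exists c.
by apply: lt_le_trans (bound G m0 no_iso); rewrite divr_gt0 ?ltr0n.
Qed.
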